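(* Let $X,Y$ be real random variables with marginal distribution functions $F,G$ respectively, and let $z\in\mathbb{R}$. If at least one of $X,Y$ is a discrete random variable (a random variable which may take on only a countable number of distinct values), then there exists a copula $C_t$, dependent only on the value of $t=\tau_W(F,G)(z)$, such that $$\sigma_{C_t}(F,G)(z)=\tau_W(F,G)(z)=t.$$ In other words, the lower bound $\tau_W(F,G)(z)$ on $J(z)=P(X+Y\le z)$ is always achievable when one of $X,Y$ is a discrete random variable.
   Context: Distribution functions are right-continuous: $F(x)=P(X\le x)$, $G(y)=P(Y\le y)$. The margins are fixed and the joint distribution is unspecified. A (two-dimensional) copula is a function $C:[0,1]^2\to[0,1]$ with $C(a,0)=C(0,a)=0$, $C(a,1)=C(1,a)=a$ for all $a\in[0,1]$, and $C(a_2,b_2)-C(a_1,b_2)-C(a_2,b_1)+C(a_1,b_1)\ge 0$ whenever $a_1\le a_2$, $b_1\le b_2$ in $[0,1]$. For a copula $C$ and real $z$, $\sigma_C(F,G)(z)=\iint_{x+y\le z}dC(F(x),G(y))$, i.e. $\sigma_C(F,G)(z)=P(X+Y\le z)$ when $(X,Y)$ has joint distribution function $H(x,y)=C(F(x),G(y))$. The Makarov lower bound is $\tau_W(F,G)(z)=\sup_{x+y=z}\max(F(x)+G(y)-1,0)$, the supremum being over real $x,y$. ''Dependent only on the value $t$'' means that the copula can be chosen as a function of the number $t\in[0,1]$ alone, the same for all $F,G,z$ giving that value. A lower bound on $J$ is achievable at $z$ if some joint distribution of $(X,Y)$ with margins $F,G$ has $J(z)$ equal to the bound at $z$. *)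

(* Defs.v *)
From HB Require Import structures.
From mathcomp Require Import all_boot all_order all_algebra.
From mathcomp Require Import all_classical all_reals all_analysis.
From mathcomp Require Import measurable_realfun.

Set Implicit Arguments.
Unset Strict Implicit.
Unset Printing Implicit Defensive.

Import Order.TTheory GRing.Theory Num.Theory.
Import numFieldNormedType.Exports.

Local Open Scope classical_set_scope.
Local Open Scope ring_scope.

(* Only the values of C on the unit square are constrained. *)
Definition is_copula (R : realType) (C : R -> R -> R) : Prop :=
  [/\ forall a b, 0 <= a <= 1 -> 0 <= b <= 1 -> 0 <= C a b <= 1,
      forall a, 0 <= a <= 1 -> C a 0 = 0 /\ C 0 a = 0,
      forall a, 0 <= a <= 1 -> C a 1 = a /\ C 1 a = a &
      forall a1 a2 b1 b2, 0 <= a1 -> a1 <= a2 -> a2 <= 1 ->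
        0 <= b1 -> b1 <= b2 -> b2 <= 1 ->
        0 <= C a2 b2 - C a1 b2 - C a2 b1 + C a1 b1].

Definition joint_df (R : realType) (mu : probability (R * R)%type R)
    (H : R -> R -> R) : Prop :=
  forall x y, mu (`]-oo, x] `*` `]-oo, y]) = (H x y)%:E.

Definition sum_le (R : realType) (z : R) : set (R * R) :=
  [set p | p.1 + p.2 <= z].

(* The integral of dC(F(x), G(y)) over x + y <= z is the mass of [sum_le z]
   under the Borel probability measure on R * R with distribution function
   C(F(x), G(y)); see [sigmaE]. The measure is unique ([joint_df_unique]), and
   the junk value -oo, which is not a probability, is returned if there is
   none, so that an equation [sigma C F G z = r%:E] includes its existence. *)
Definition sigma (R : realType) (C : R -> R -> R) (F G : R -> R) (z : R) :
    \bar R :=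
  xget -oo%E [set s | exists mu : probability (R * R)%type R,
    joint_df mu (fun x y => C (F x) (G y)) /\ s = mu (sum_le z)].

Definition tauW (R : realType) (F G : R -> R) (z : R) : R :=
  sup [set s | exists x y, x + y = z /\ s = Num.max (F x + G y - 1) 0].

Definition achievable_at (R : realType) (F G : R -> R) (z b : R) : Prop :=
  exists mu : probability (R * R)%type R,
    [/\ forall x, mu (`]-oo, x] `*` setT) = (F x)%:E,
        forall y, mu (setT `*` `]-oo, y]) = (G y)%:E &
        mu (sum_le z) = b%:E].

Section uniqueness.
Variable R : realType.

Let quadrants : set (set (R * R)) :=
  [set A | exists x y : R, A = `]-oo, x] `*` `]-oo, y]].

Let rays_sub (S : set (set R)) : sigma_algebra setT S ->
  (forall x : R, S [set` `]-oo, x]]) -> measurable `<=` S.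
Proof.
move=> sS Sray; have [S0 SC SU] := sS.
have SCc B : S B -> S (~` B) by move=> SB; rewrite -setTD; exact: SC.
apply: smallest_sub => // _ [[a b] _ <-] /=.
have -> : `]a, b]%classic = ~` (~` `]-oo, b] `|` `]-oo, a]).
  rewrite setCU setCK setCitvl; apply/seteqP; split=> y /=;
    rewrite !in_itv/= andbT; first by move=> /andP[-> ->].
  by move=> [-> ->].
apply: (SCc); rewrite -bigcup2E; apply: SU => -[|[|n]] //=; exact: SCc.
Qed.

Let bigcup_rays : \bigcup_n `]-oo, n%:R : R]%classic = [set: R].
Proof.
rewrite -subTset => y _; exists (Num.truncn `|y|).+1 => //=.
rewrite in_itv/=; apply: le_trans (ler_norm y) _.
by apply/ltW; rewrite truncnS_gt.
Qed.

Let measurable_quadrants : measurable = <<s quadrants >>.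
Proof.
have sQ : sigma_algebra setT <<s quadrants >> by exact: smallest_sigma_algebra.
have [S0 SC SU] := sQ.
have SCc B : <<s quadrants >> B -> <<s quadrants >> (~` B).
  by move=> SB; rewrite -setTD; exact: SC.
rewrite eqEsubset; split; last first.
  apply: smallest_sub; first exact: sigma_algebra_measurable.
  by move=> _ [x [y ->]]; exact: measurableX.
apply: smallest_sub => // A [] [B mB <-]; rewrite setTI.
- apply: (@rays_sub [set B | <<s quadrants >> (fst @^-1` B)]) mB.
    split => [|C QC|C QC] /=.
    + by rewrite preimage_set0.
    + by rewrite setTD preimage_setC; exact: SCc.
    + by rewrite preimage_bigcup; exact: SU.
  move=> x /=; have -> : fst @^-1` `]-oo, x] =
      \bigcup_n (`]-oo, x] `*` `]-oo, n%:R]) :> set (R * R).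
    by rewrite -setX_bigcupr bigcup_rays -setXT.
  by apply: SU => n; apply: sub_sigma_algebra; exists x, n%:R.
- apply: (@rays_sub [set B | <<s quadrants >> (snd @^-1` B)]) mB.
    split => [|C QC|C QC] /=.
    + by rewrite preimage_set0.
    + by rewrite setTD preimage_setC; exact: SCc.
    + by rewrite preimage_bigcup; exact: SU.
  move=> x /=; have -> : snd @^-1` `]-oo, x] =
      \bigcup_n (`]-oo, n%:R] `*` `]-oo, x]) :> set (R * R).
    by rewrite -setX_bigcupl bigcup_rays -setTX.
  by apply: SU => n; apply: sub_sigma_algebra; exists n%:R, x.
Qed.

Lemma joint_df_unique (mu nu : probability (R * R)%type R) (H : R -> R -> R) :
  joint_df mu H -> joint_df nu H -> forall A, measurable A -> mu A = nu A.
Proof.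
move=> muH nuH A.
apply: (measure_unique quadrants (fun n => `]-oo, n%:R] `*` `]-oo, n%:R])).
- exact: measurable_quadrants.
- move=> _ _ [x1 [y1 ->]] [x2 [y2 ->]].
  exists (Num.min x1 x2), (Num.min y1 y2).
  by apply/seteqP; split=> -[u v] /=; rewrite !in_itv/= !le_min;
    [move=> [[-> ->] [-> ->]]|move=> [/andP[-> ->] /andP[-> ->]]].
- by move=> n; exists n%:R, n%:R.
- rewrite -subTset => -[x y] _.
  have /= [n _ xn] : (\bigcup_n `]-oo, n%:R : R]%classic) x by rewrite bigcup_rays.
  have /= [m _ ym] : (\bigcup_n `]-oo, n%:R : R]%classic) y by rewrite bigcup_rays.
  move: xn ym; rewrite /= !in_itv/= => xn ym.
  exists (maxn n m) => //; split; rewrite /= in_itv/=.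
  + by rewrite (le_trans xn)// ler_nat leq_maxl.
  + by rewrite (le_trans ym)// ler_nat leq_maxr.
- by move=> _ [x [y ->]]; exact: etrans (muH x y) (esym (nuH x y)).
- move=> n; apply: (@le_lt_trans _ _ 1%E); last exact: ltry.
  by apply: probability_le1; exact: measurableX.
Qed.

Lemma measurable_sum_le (z : R) : measurable (sum_le z).
Proof.
have mD : measurable_fun setT (fun p : R * R => p.1 + p.2).
  by apply: measurable_funD;
    [exact: measurable_fst|exact: measurable_snd].
have := mD measurableT `]-oo, z]%classic (measurable_itv _).
by rewrite setTI; congr (measurable _); apply/seteqP; split=> p /=;
  rewrite in_itv.
Qed.

Lemma sigmaE (C : R -> R -> R) (F G : R -> R) (z : R)
    (mu : probability (R * R)%type R) :
  joint_df mu (fun x y => C (F x) (G y)) -> sigma C F G z = mu (sum_le z).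
Proof.
move=> muH; rewrite /sigma;
  case: xgetP => [_ -> [nu [nuH ->]]|/(_ (mu (sum_le z)))].
  by apply: (joint_df_unique nuH muH); exact: measurable_sum_le.
by case; exists mu.
Qed.

End uniqueness.

(* Main.v *)
Require Import Defs.
From HB Require Import structures.
From mathcomp Require Import all_boot all_order all_algebra.
From mathcomp Require Import all_classical all_reals all_analysis.
From mathcomp Require Import measurable_realfun lra.

Set Implicit Arguments.
Unset Strict Implicit.
Unset Printing Implicit Defensive.

Import Order.TTheory GRing.Theory Num.Theory.
Import numFieldNormedType.Exports.

Local Open Scope classical_set_scope.
Local Open Scope ring_scope.

(** Let U be uniform on ]0, 1[ and let V = [flip t U] be U when U <= t and
    1 + t - U otherwise. Then V is uniform as well, and C_t is the joint
    distribution function of (U, V): all its mass below t is comonotone, all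
    its mass above t is countermonotone. If q and r are the quantile functions
    of F and G, the pair (q U, r V) has distribution function C_t(F x, G y)
    because q u <= x iff u <= F x, and likewise for r.

    Write t for the Makarov bound at z. Every joint distribution with margins F
    and G gives mass at least t to the half-plane x + y <= z, by the
    Fréchet bound on the quadrants that it contains. For the converse, the part
    U <= t has probability t, so it suffices that the part U > t adds nothing.
    If q U + r V <= z with U > t, put x = q U. Then U <= F x, and r V <= z - x
    gives 1 + t - U = V <= G (z - x) <= 1 + t - F x, the last step because t
    bounds F x + G (z - x) - 1. Hence U = F (q U), and V = G (r V) by the
    symmetric argument ([fns_sum_le]). Thus U is determined by q U, and also
    by r V. When X is discrete, q U almost surely takes countably many values,
    so U would lie in a countable set, which has probability 0; when Y is
    discrete, the same holds with r V ([negligible_function_of_discrete]).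
    Discreteness cannot be dropped: with U = F (q U) for all U, as for
    continuous F, the line x + y = z may carry the whole mass 1 - t. *)

(** * The uniform distribution and its partial reflection *)

(** The open interval is used because a quantile function is finite only
    there. *)
Definition unif01 (R : realType) :=
  mrestr (@lebesgue_measure R) (measurable_itv `]0%R, 1%R[).
Arguments unif01 : clear implicits.

HB.instance Definition _ (R : realType) := Measure.on (unif01 R).

Lemma unif01_setT (R : realType) : unif01 R setT = 1%E.
Proof.
by rewrite /unif01 /mrestr setTI lebesgue_measure_itv/= lte_fin ltr01 sube0.
Qed.

HB.instance Definition _ (R : realType) :=
  Measure_isProbability.Build _ _ _ (unif01 R) (unif01_setT R).

Section uniform.
Variable R : realType.
Implicit Types (A B : set R) (a b c d t u : R).

Lemma eq_unif01 A B : (forall u, 0 < u < 1 -> A u <-> B u) ->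
  unif01 R A = unif01 R B.
Proof.
move=> AB; rewrite /unif01 /mrestr; congr lebesgue_measure.
by apply/seteqP; split=> u /= [] + /[dup]; rewrite {1}in_itv/= => + /AB;
  move=> + h => /h.
Qed.

Lemma le_unif01 A B : measurable A -> measurable B ->
  (forall u, 0 < u < 1 -> A u -> B u) -> (unif01 R A <= unif01 R B)%E.
Proof.
move=> mA mB AB; rewrite /unif01 /mrestr.
apply: le_measure; rewrite ?inE; [exact: measurableI..|].
by move=> u /= [Au]; rewrite in_itv/= => u01; split=> //; exact: AB.
Qed.

Lemma unif01_itvoo c d : 0 <= c -> c <= d -> d <= 1 ->
  unif01 R `]c, d[ = (d - c)%:E.
Proof.
move=> c0 cd d1; rewrite /unif01 /mrestr setIidl; last first.
  by apply: subset_itv; rewrite bnd_simp.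
rewrite lebesgue_measure_itv/= lte_fin; case: ltP => [//|dc].
by rewrite (@le_anti _ _ c d) ?cd// subrr.
Qed.

Lemma unif01_le a : 0 <= a <= 1 -> unif01 R [set u | u <= a] = a%:E.
Proof.
move=> /andP[a0 a1]; rewrite (@eq_unif01 _ (~` `]a, 1[%classic)); last first.
  move=> u /andP[_ u1] /=; rewrite in_itv/= u1 andbT leNgt.
  by split=> [/negP|] //; move/negP.
by rewrite [LHS]probability_setC//= unif01_itvoo// -EFinB opprB addrCA subrr
  addr0.
Qed.

Lemma unif01_countable A : countable A -> unif01 R A = 0%E.
Proof.
move=> cA; apply: countable_lebesgue_measure0.
exact: sub_countable (subset_card_le (@subIsetl _ _ _)) cA.
Qed.

Definition flip t u := if u <= t then u else 1 + t - u.

Lemma measurable_flip t : measurable_fun setT (flip t).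
Proof.
apply: measurable_fun_ifT => //.
  by apply: measurable_fun_ler => //; exact: measurable_cst.
by apply: measurable_funB => //; exact: measurable_cst.
Qed.

Lemma flip01 t u : 0 <= t <= 1 -> 0 < u < 1 -> 0 < flip t u < 1.
Proof. by move=> t01 u01; rewrite /flip; case: (leP u t) => ut; lra. Qed.

(** The reflection u |-> 1 + t - u maps ]t, 1[ onto itself and preserves
    lengths, so that [flip t] preserves the uniform distribution: below t the
    event is a ray, above t it is the complement of ]t, 1 + t - b[. *)
Lemma unif01_flip_le t b : 0 <= t <= 1 -> 0 <= b <= 1 ->
  unif01 R [set u | flip t u <= b] = b%:E.
Proof.
move=> t01 b01; have [bt|tb] := ltP b t.
  rewrite -[RHS]unif01_le//; apply: eq_unif01 => u u01 /=.
  by rewrite /flip; case: (leP u t) => // tu; split=> ?; lra.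
rewrite (@eq_unif01 _ (~` `]t, 1 + t - b[%classic)); last first.
  move=> u u01 /=; rewrite in_itv/= /flip.
  by case: (leP u t) => ut /=; split=> [h|/negP h]; try apply/negP; lra.
rewrite [LHS]probability_setC//= unif01_itvoo; [|lra..].
by rewrite -EFinB; congr EFin; lra.
Qed.

End uniform.

(** * The copula *)

Section copula.
Variable R : realType.
Implicit Types (a b t : R).

(** This is the copula of Frank, Nelsen and Schweizer: on the unit square it
    equals max(a + b - 1, t) when t <= a and t <= b, and min(a, b) elsewhere.
    Taking it as a joint distribution function makes the rectangle inequality
    the positivity of a probability. *)
Definition fns_copula t a b :=
  fine (unif01 R [set u | u <= a /\ flip t u <= b]).

Lemma measurable_fns_event t a b :
  measurable [set u | u <= a /\ flip t u <= b].
Proof.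
have m1 : measurable [set u | u <= a] by rewrite -set_itvNyc.
have m2 : measurable [set u | flip t u <= b].
  rewrite -[X in measurable X](_ : flip t @^-1` `]-oo, b] = _).
    by rewrite -[X in measurable X]setTI; exact: measurable_flip.
  by rewrite set_itvNyc.
exact: measurableI.
Qed.

Lemma fns_copulaE t a b :
  unif01 R [set u | u <= a /\ flip t u <= b] = (fns_copula t a b)%:E.
Proof.
by rewrite fineK// fin_num_measure//; exact: measurable_fns_event.
Qed.

(** Any joint distribution function of two uniform variables is a copula; the
    boundary values are the two uniform margins. *)
Lemma fns_copula_is_copula t : 0 <= t <= 1 -> is_copula (fns_copula t).
Proof.
move=> t01; split.
- move=> a b _ _; rewrite -!lee_fin -fns_copulaE measure_ge0.
  by rewrite probability_le1//; exact: measurable_fns_event.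
- move=> a a01; split; apply: EFin_inj; rewrite -fns_copulaE;
    (transitivity (unif01 R set0); last exact: measure0).
    by apply: eq_unif01 => u /(flip01 t01); split=> //= -[_]; lra.
  by apply: eq_unif01 => u u01; split=> //= -[]; lra.
- move=> a a01; split; apply: EFin_inj; rewrite -fns_copulaE.
    rewrite -[RHS]unif01_le//; apply: eq_unif01 => u /(flip01 t01) f01.
    by split=> /= [[]|ua] //; split=> //; lra.
  rewrite -[RHS](unif01_flip_le t01)//; apply: eq_unif01 => u u01.
  by split=> /= [[]|ua] //; split=> //; lra.
- move=> a1 a2 b1 b2 a10 a12 a21 b10 b12 b21.
  (* Inclusion-exclusion for the two events that exhaust the complement of the
     rectangle in the quadrant with corner (a2, b2). *)
  pose D a b := [set u | u <= a /\ flip t u <= b].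
  have mD a b : measurable (D a b) by exact: measurable_fns_event.
  have sub : D a1 b2 `|` D a2 b1 `<=` D a2 b2.
    by move=> u [|] [ua ub]; split; lra.
  have DI : D a1 b2 `&` D a2 b1 = D a1 b1.
    apply/seteqP; split=> u; rewrite /D/=; first by move=> [[? _] [_ ?]].
    by move=> [ua ub]; repeat split; lra.
  have : (unif01 R (D a1 b2 `|` D a2 b1) <= unif01 R (D a2 b2))%E.
    by apply: le_measure; rewrite ?inE;
      [apply: measurableU; exact: mD|exact: mD|].
  rewrite measureUfinl;
    [|exact: mD|exact: mD|by rewrite /= /D fns_copulaE ltry].
  by rewrite DI /= /D !fns_copulaE -!EFinD lee_fin; lra.
Qed.

End copula.

(** * Quantile functions *)

(** The Galois connection on ]0, 1[ is the only property of a quantile function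
    that the coupling uses. *)
Definition is_quantile (R : realType) (F q : R -> R) : Prop :=
  measurable_fun setT q /\ forall u x, 0 < u < 1 -> (q u <= x) = (u <= F x).

Section quantile.
Variables (R : realType) (d : measure_display) (T : measurableType d).
Variables (P : probability T R) (X : {RV P >-> R}) (F : R -> R).
Hypothesis XF : forall x, cdf X x = (F x)%:E.

Let FE : fine \o cdf X = F.
Proof. by apply/funext => x /=; rewrite XF. Qed.

Let F_nd x y : x <= y -> F x <= F y.
Proof. by move=> xy; rewrite -lee_fin -!XF; exact: cdf_nondecreasing. Qed.

Let F_rc x : F y @[y --> x^'+] --> F x.
Proof.
rewrite -FE; apply: fine_cvg; rewrite /= XF -XF.
exact: cdf_right_continuous.
Qed.

Let quantile u := inf [set x | u <= F x].

Let quantileP u x : 0 < u < 1 -> (quantile u <= x) = (u <= F x).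
Proof.
move=> /andP[u0 u1].
have [y yF] : exists y, u <= F y.
  have Fy : F @ +oo --> (1 : R) by rewrite -FE; apply: fine_cvg; exact: cvg_cdfy1.
  have [y [_ /(_ (y + 1))]] := cvgr_gt _ Fy _ u1.
  by rewrite ltrDl ltr01 => /(_ isT) /ltW ?; exists (y + 1).
have [l lF] : exists l, F l < u.
  have Fy : F @ -oo --> (0 : R) by rewrite -FE; apply: fine_cvg; exact: cvg_cdfNy0.
  have [l [_ /(_ (l - 1))]] := cvgr_lt _ Fy _ u0.
  by rewrite gtrDl oppr_lt0 ltr01 => /(_ isT) ?; exists (l - 1).
have lb : has_lbound [set x | u <= F x].
  exists l => s /= us; rewrite leNgt; apply/negP => /ltW /F_nd; lra.
apply/idP/idP => [qx|]; last exact: (ge_inf lb).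
(* The infimum is attained by right-continuity: u <= F s for every s > x. *)
have near_x : \forall s \near x^'+, u <= F s.
  near=> s; have xs : x < s by near: s; exact: nbhs_right_gt.
  have [|v /= uv vs] :=
      @inf_adherent _ _ (s - quantile u) _ (conj (ex_intro _ y yF) lb).
    by rewrite subr_gt0 (le_lt_trans qx).
  by rewrite (le_trans uv)// F_nd//; rewrite /quantile in vs; lra.
exact: (closed_cvg _ (@closed_ge _ u) near_x _ (F_rc (x := x))).
Unshelve. all: by end_near. Qed.

Lemma quantile_exists : exists q, is_quantile F q.
Proof.
have mD := measurable_itv `]0%R : R, 1[.
(* Outside ]0, 1[ the infimum may be over an unbounded or an empty set. *)
exists (quantile \_ `]0, 1[%classic); split=> [|u x u01]; last first.
  by rewrite patchE mem_set/= ?in_itv//= quantileP.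
apply/(measurable_restrictT _ mD).
apply: (measurability (@RGenOInfty.G R)) => [|/= _ [_] [x] -> <-].
  exact: RGenOInfty.measurableE.
rewrite (_ : _ `&` _ = `]0, 1[ `&` `]F x, +oo[); first exact: measurableI.
by apply/seteqP; split=> u /= [/[dup] + -> +]; rewrite !in_itv/= !andbT => u01;
  rewrite !ltNge quantileP.
Qed.

End quantile.

(** * Laws of random variables *)

Section law.
Variable R : realType.

Lemma exists_law d (T : measurableType d) (P : probability T R) (f g : T -> R) :
  measurable_fun setT f -> measurable_fun setT g ->
  exists mu : probability (R * R)%type R,
    forall A, mu A = P [set w | A (f w, g w)].
Proof.
move=> mf mg.
pose Z : {mfun T >-> (R * R)%type} :=
  mfun_Sub (mem_set (measurable_fun_pair mf mg)).
by exists (distribution P Z).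
Qed.

(** A law on the line is determined by its distribution function; this follows
    from the uniqueness for laws on the plane, applied to the laws of (f1, f1)
    and (f2, f2), whose value on a quadrant depends only on the smaller
    coordinate of its corner. *)
Lemma eq_law_of_cdf d1 d2 (T1 : measurableType d1) (T2 : measurableType d2)
    (P1 : probability T1 R) (P2 : probability T2 R) (f1 : T1 -> R)
    (f2 : T2 -> R) :
  measurable_fun setT f1 -> measurable_fun setT f2 ->
  (forall x, P1 [set w | f1 w <= x] = P2 [set w | f2 w <= x]) ->
  forall A, measurable A -> P1 (f1 @^-1` A) = P2 (f2 @^-1` A).
Proof.
move=> m1 m2 f12 A mA.
have [mu1 mu1E] := exists_law P1 m1 m1.
have [mu2 mu2E] := exists_law P2 m2 m2.
pose H x y := fine (P2 [set w | f2 w <= Num.min x y]).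
have HE x y : P2 [set w | f2 w <= Num.min x y] = (H x y)%:E.
  rewrite fineK// fin_num_measure//.
  have := m2 measurableT `]-oo, Num.min x y]%classic (measurable_itv _).
  by rewrite setTI -[X in measurable (_ @^-1` X)]set_itvNyc.
have quadrant (U : Type) (f : U -> R) x y :
    [set w | (`]-oo, x] `*` `]-oo, y]) (f w, f w)] =
    [set w | f w <= Num.min x y].
  by apply/seteqP; split=> w /=; rewrite !in_itv/= le_min;
    [move=> [-> ->]|move/andP].
have mu1H : joint_df mu1 H by move=> x y; rewrite mu1E quadrant f12 HE.
have mu2H : joint_df mu2 H by move=> x y; rewrite mu2E quadrant HE.
have := joint_df_unique mu1H mu2H (measurableX mA (@measurableT _ R)).
rewrite mu1E mu2E.
have XT (U : Type) (f : U -> R) :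
    [set w | (A `*` setT) (f w, f w)] = f @^-1` A.
  by apply/seteqP; split=> w //= [].
by rewrite !XT.
Qed.

(** If g U has the law of a discrete variable X, then almost surely g U lies in
    the countable range of X; where moreover U = h (g U), the value of U lies in
    the countable image of that range under h, which the uniform distribution
    does not charge. *)
Lemma negligible_function_of_discrete d (T : measurableType d)
    (P : probability T R) (X : {RV P >-> R}) (g h : R -> R) :
  countable (range X) -> measurable_fun setT g ->
  (forall x, unif01 R [set u | g u <= x] = cdf X x) ->
  exists2 N : set R, measurable N /\ unif01 R N = 0%E &
    forall u, u = h (g u) -> N u.
Proof.
move=> cX mg gX.
have m_countable (A : set R) : countable A -> measurable A.
  by apply: countable_measurable => x; exact: measurable_set1.
have mX : measurable (~` range X) by apply: measurableC; exact: m_countable.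
have cN : countable (h @` range X).
  exact: sub_countable (card_image_le _ _) cX.
have mN : measurable (h @` range X) by exact: m_countable.
have mM : measurable (g @^-1` (~` range X)).
  by rewrite -[X in measurable X]setTI; exact: mg.
exists (g @^-1` (~` range X) `|` h @` range X); last first.
  move=> u uhg; have [gu|] := pselect (range X (g u)); last by left.
  by right; exists (g u).
split; first exact: measurableU.
apply/eqP; rewrite eq_le measure_ge0 andbT.
have -> : 0%E = (unif01 R (g @^-1` (~` range X)) + unif01 R (h @` range X))%E.
  rewrite (unif01_countable cN) adde0.
  rewrite (eq_law_of_cdf (P1 := unif01 R) (P2 := P) (f2 := X) mg)//.
  rewrite (_ : X @^-1` _ = set0) ?measure0//.
  by rewrite -subset0 => w /=; apply; exists w.
exact: (measureU2 (unif01 R) mM mN).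
Qed.

Lemma probability_setI_ge d (T : measurableType d) (P : probability T R)
    (A B : set T) :
  measurable A -> measurable B -> (P A + P B - 1 <= P (A `&` B))%E.
Proof.
move=> mA mB.
have fA : P A \is a fin_num by exact: fin_num_measure.
have fB : P B \is a fin_num by exact: fin_num_measure.
have fAB : P (A `&` B) \is a fin_num.
  by apply: fin_num_measure => //; exact: measurableI.
have := probability_le1 P (measurableU _ _ mA mB).
rewrite measureUfinl//=; last by rewrite -ge0_fin_numE.
move: fA fB fAB; case: (P A) => // a; case: (P B) => // b.
case: (P (A `&` B)) => // c _ _ _.
by rewrite -!EFinD !lee_fin; lra.
Qed.

End law.

(** * The Makarov bound *)

Section makarov.
Variables (R : realType) (F G : R -> R) (z : R).

Lemma tauW_le b : 0 <= b -> (forall x y, x + y = z -> F x + G y - 1 <= b) ->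
  tauW F G z <= b.
Proof.
move=> b0 FGb; apply: ge_sup.
  by exists (Num.max (F 0 + G z - 1) 0), 0, z; rewrite add0r.
by move=> _ [x [y [xyz ->]]]; rewrite ge_max b0 FGb.
Qed.

Hypotheses (F01 : forall x, 0 <= F x <= 1) (G01 : forall y, 0 <= G y <= 1).

Lemma tauW_ge x y : x + y = z -> Num.max (F x + G y - 1) 0 <= tauW F G z.
Proof.
move=> xyz; apply: ub_le_sup; last by exists x, y.
exists 1 => _ [x' [y' [_ ->]]]; rewrite ge_max ler01 andbT.
by have := F01 x'; have := G01 y'; lra.
Qed.

Lemma tauW01 : 0 <= tauW F G z <= 1.
Proof.
apply/andP; split; last first.
  apply: tauW_le => // x y _.
  by have := F01 x; have := G01 y; lra.
apply: le_trans (tauW_ge (add0r z)).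
by rewrite le_max lexx orbT.
Qed.

End makarov.

(** On the countermonotone part the half-plane is met only at its boundary, in
    the sense of probability levels: u <= F (q u) and v <= G (r v) always hold
    for v = [flip t u], while u + v = 1 + t and t bounds F + G - 1 along the
    line x + y = z. *)
Lemma fns_sum_le (R : realType) (F G q r : R -> R) (t z u : R) :
  is_quantile F q -> is_quantile G r -> 0 <= t <= 1 -> 0 < u < 1 ->
  (forall x y, x + y = z -> F x + G y - 1 <= t) ->
  q u + r (flip t u) <= z -> t < u ->
  F (q u) = u /\ G (r (flip t u)) = flip t u.
Proof.
move=> [_ qP] [_ rP] t01 u01 FGt qrz tu.
have v01 := flip01 t01 u01.
have uF : u <= F (q u) by rewrite -qP.
have vG : flip t u <= G (r (flip t u)) by rewrite -rP.
have rz : r (flip t u) <= z - q u by lra.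
have vGz : flip t u <= G (z - q u) by rewrite -rP.
have qz : q u <= z - r (flip t u) by lra.
have uFz : u <= F (z - r (flip t u)) by rewrite -qP.
have := FGt (q u) (z - q u); have := FGt (z - r (flip t u)) (r (flip t u)).
rewrite subrK addrCA subrr addr0 => /(_ erefl) h1 /(_ erefl) h2.
have vE : flip t u = 1 + t - u by rewrite /flip leNgt tu.
by split; lra.
Qed.

Theorem theorem15 (R : realType) :
  exists C : R -> R -> R -> R,
    (forall t : R, 0 <= t <= 1 -> is_copula (C t)) /\
    forall (d1 d2 : measure_display)
      (T1 : measurableType d1) (T2 : measurableType d2)
      (P1 : probability T1 R) (P2 : probability T2 R)
      (X : {RV P1 >-> R}) (Y : {RV P2 >-> R}) (F G : R -> R) (z : R),
      (forall x : R, cdf X x = (F x)%:E) ->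
      (forall y : R, cdf Y y = (G y)%:E) ->
      countable (range X) \/ countable (range Y) ->
      sigma (C (tauW F G z)) F G z = (tauW F G z)%:E /\
      achievable_at F G z (tauW F G z).
Proof.
exists (@fns_copula R); split=> [|d1 d2 T1 T2 P1 P2 X Y F G z XF YG XY].
  exact: fns_copula_is_copula.
have F01 x : 0 <= F x <= 1 by rewrite -!lee_fin -XF cdf_ge0 cdf_le1.
have G01 x : 0 <= G x <= 1 by rewrite -!lee_fin -YG cdf_ge0 cdf_le1.
set t := tauW F G z.
have t01 : 0 <= t <= 1 by exact: tauW01.
have FGt x y : x + y = z -> F x + G y - 1 <= t.
  by move=> /(tauW_ge F01 G01); apply: le_trans; rewrite le_max lexx.
have [q qF] := quantile_exists XF.
have [r rG] := quantile_exists YG.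
have [[mq qP] [mr rP]] := (qF, rG).
have mrf : measurable_fun setT (r \o flip t).
  by apply: measurableT_comp => //; exact: measurable_flip.
have [mu muE] := exists_law (unif01 R) mq mrf.
have qUF x : unif01 R [set u | q u <= x] = (F x)%:E.
  by rewrite -[RHS]unif01_le//; apply: eq_unif01 => u u01 /=; rewrite qP.
have rVG y : unif01 R [set u | r (flip t u) <= y] = (G y)%:E.
  rewrite -[RHS](unif01_flip_le t01)//; apply: eq_unif01 => u u01 /=.
  by rewrite rP//; exact: flip01.
have muC : joint_df mu (fun x y => fns_copula t (F x) (G y)).
  move=> x y; rewrite muE -fns_copulaE; apply: eq_unif01 => u u01 /=.
  by rewrite !in_itv/= qP// rP//; exact: flip01.
have muX x : mu (`]-oo, x] `*` setT) = (F x)%:E.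
  rewrite muE -qUF; apply: eq_unif01 => u _ /=.
  by rewrite in_itv/=; split=> [[]|].
have muY y : mu (setT `*` `]-oo, y]) = (G y)%:E.
  rewrite muE -rVG; apply: eq_unif01 => u _ /=.
  by rewrite in_itv/=; split=> [[]|].
have mS := measurable_sum_le z.
suff muS : mu (sum_le z) = t%:E by split; [rewrite (sigmaE z muC)|exists mu].
apply/le_anti/andP; split; last first.
  have fS : mu (sum_le z) \is a fin_num by exact: fin_num_measure.
  rewrite -(fineK fS) lee_fin; apply: tauW_le.
    by rewrite fine_ge0.
  move=> x y xyz; rewrite -lee_fin fineK// EFinB EFinD -muX -muY.
  have mA : measurable (`]-oo, x] `*` [set: R]) by exact: measurableX.
  have mB : measurable ([set: R] `*` `]-oo, y]) by exact: measurableX.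
  apply: le_trans (probability_setI_ge mu mA mB) _.
  apply: le_measure; rewrite ?inE//; first exact: measurableI.
  move=> [a b] /=; rewrite /sum_le !in_itv/= => -[[ax _] [_ by_]].
  by rewrite -xyz lerD.
have [N [mN N0] SN] : exists2 N, measurable N /\ unif01 R N = 0%E &
    forall u, 0 < u < 1 -> q u + r (flip t u) <= z -> t < u -> N u.
  case: XY => [cX|cY].
    have [x|N mN NP] := negligible_function_of_discrete (X := X) F cX mq.
      by rewrite XF qUF.
    exists N => // u u01 qrz tu; apply: NP.
    by have [] := fns_sum_le qF rG t01 u01 FGt qrz tu.
  (* Solving V = 1 + t - U for U gives U = 1 + t - G (r V). *)
  have [y|N mN NP] := negligible_function_of_discrete (X := Y)
      (fun y => 1 + t - G y) cY mrf.
    by rewrite YG rVG.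
  exists N => // u u01 qrz tu; apply: NP => /=.
  have [_ ->] := fns_sum_le qF rG t01 u01 FGt qrz tu.
  by rewrite /flip leNgt tu /=; lra.
have mt : measurable [set u : R | u <= t] by rewrite -set_itvNyc.
rewrite muE -(unif01_le t01) -[leRHS]adde0 -N0.
apply: le_trans (measureU2 (unif01 R) mt mN).
apply: le_unif01; last first.
- by move=> u u01 qrz; have [ut|tu] := leP u t; [left|right; exact: SN].
- exact: measurableU.
- rewrite -[X in measurable X]setTI.
  exact: (measurable_fun_pair mq mrf measurableT mS).
Qed.
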